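(* For every integer $j \ge 0$, \[ \frac{1}{(j+2)!} \le \liminf_{n\to\infty} \frac{s_j(n)}{n} \le \limsup_{n\to\infty} \frac{s_j(n)}{n} \le \frac{1}{j+2}. \]
   Context: For positive integers $n,k$, $n \bmod k$ denotes the least nonnegative remainder of $n$ upon division by $k$. For a positive integer $n$, define the iterated remainder sets inductively by $S_0(n) := \{1,2,\ldots,\lfloor n/2\rfloor\}$ and $S_j(n) := \{ n \bmod k : k \in S_{j-1}(n)\setminus\{0\}\}$ for $j \ge 1$, and let $s_j(n) := |S_j(n)|$. *)

(* Defs.v *)
From mathcomp Require Import all_boot finmap.

Set Implicit Arguments.
Unset Strict Implicit.
Unset Printing Implicit Defensive.

Local Open Scope nat_scope.
Local Open Scope fset_scope.

Fixpoint iter_rem_set (j n : nat) : {fset nat} :=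
  if j is i.+1 then [fset (n %% k)%N | k in iter_rem_set i n `\ 0%N]
  else [fset k in iota 1 n./2].

Definition iter_rem_card (j n : nat) : nat := #|` iter_rem_set j n|.

(* Main.v *)
(** Since [n = q k + n %% k] with [n %% k < k], every [k <= n / (j+1)] has
    [q >= j+1] and hence [n %% k < n / (j+2)]; so [S_j(n)] lies in
    [[0, n / (j+2)]].  Conversely, for [n / (j+2) < k <= n / (j+1)] the remainder
    is exactly [n - (j+1) k].  If [S_(j-1)(n)] contains the part of a residue
    class modulo [j!] lying in [(0, n / (j+1))], then [S_j(n)] thus contains the
    part of a residue class modulo [(j+1)!] lying in [(0, n / (j+2))], which has
    [n / (j+2)! + O(1)] elements. *)
Require Import Defs.
From mathcomp Require Import finmap zify.
From mathcomp Require Import all_boot all_order all_algebra.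
From mathcomp Require Import all_classical all_reals all_analysis.

Import Order.TTheory GRing.Theory Num.Theory.

Local Open Scope ring_scope.

Lemma iter_rem_setS (j n k : nat) :
  k \in iter_rem_set j n -> (0 < k)%N -> (n %% k)%N \in iter_rem_set j.+1 n.
Proof.
move=> kS k0; apply/imfsetP; exists k => //=.
by rewrite in_fsetD1 -lt0n k0.
Qed.

Lemma iter_rem_set_le (j n r : nat) :
  r \in iter_rem_set j n -> (r * j.+2 <= n)%N.
Proof.
elim: j r => [|j IH] r /=; first by rewrite in_fset mem_iota; lia.
case/imfsetP => k /=; rewrite in_fsetD1 => /andP[k0 /IH kn] ->.
have km := ltn_pmod n (ltac:(lia) : 0 < k)%N.
have qj : (j.+2 <= n %/ k)%N by rewrite leq_divRL; lia.
have nE := divn_eq n k; nia.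
Qed.

Lemma iter_rem_set_progression (j n : nat) :
  exists2 a, (a < j.+1`!)%N & forall r, (0 < r)%N -> (r * j.+2 < n)%N ->
    r = a %[mod j.+1`!] -> r \in iter_rem_set j n.
Proof.
elim: j => [|j [a aM IH]].
  by exists 0%N => // r r0 rn _; rewrite in_fset mem_iota; lia.
set m := j.+1`! in aM IH *.
have -> : j.+2`! = (j.+2 * m)%N by rewrite factS.
(* The remainders produced are [r = n - j.+2 * k] with [k] congruent to [a] modulo [m], which fixes
   [r] modulo [j.+2 * m]. Adding [j.+2 * m] keeps the subtraction from truncating, since [a < m]. *)
exists ((n + j.+2 * m - j.+2 * a) %% (j.+2 * m))%N => [|r r0 rn].
  by rewrite ltn_mod muln_gt0 fact_gt0.
rewrite modn_mod => rE.
have am : (j.+2 * a <= j.+2 * m)%N by rewrite leq_mul2l; lia.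
have rlen : (r <= n)%N by apply: leq_trans (ltnW rn); rewrite leq_pmulr.
have nE : n - r = j.+2 * a %[mod j.+2 * m].
  apply/eqP; rewrite -(eqn_modDl r) subnKC//.
  rewrite -[in eqbRHS]modnDml rE modnDml subnK; last by lia.
  by rewrite modnDr.
have /dvdnP[k kE] : (j.+2 %| n - r)%N.
  rewrite /dvdn -(@modn_dvdm (j.+2 * m)) ?dvdn_mulr// nE modn_dvdm ?dvdn_mulr//.
  by rewrite modnMr.
have nkr : n = (k * j.+2 + r)%N by rewrite -kE subnK.
(* Strictness of [rn] matters: if [r * j.+3 = n], then [k = r] and the remainder is 0. *)
have rk : (r < k)%N.
  by rewrite -(@ltn_pmul2r j.+2)// -(ltn_add2r r) -nkr -mulnSr.
have -> : r = (n %% k)%N by rewrite nkr mulnC modnMDl modn_small.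
apply: iter_rem_setS; last exact: leq_ltn_trans rk.
apply: IH; first exact: leq_ltn_trans rk.
  (* Here [0 < r] gives the strict bound [k * j.+2 < n]. *)
  by rewrite nkr -[ltnLHS]addn0 ltn_add2l.
(* Cancelling [j.+2] from both sides and the modulus of [nE] leaves [k = a] modulo [m]. *)
by move/eqP: nE; rewrite kE mulnC -!muln_modr eqn_pmul2l// => /eqP.
Qed.

Lemma iter_rem_card_le (j n : nat) : (iter_rem_card j n <= (n %/ j.+2).+1)%N.
Proof.
rewrite -[leqRHS](size_iota 0) -[iota _ _]undup_id ?iota_uniq// -card_fseq.
apply: fsubset_leq_card; apply/fsubsetP => r /iter_rem_set_le rn.
by rewrite in_fset mem_iota /= add0n ltnS leq_divRL.
Qed.

Lemma iter_rem_card_ge (j n : nat) : (n %/ j.+2`! <= (iter_rem_card j n).+1)%N.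
Proof.
have [a aM aS] := iter_rem_set_progression j n.
set m := j.+1`! in aM aS.
have mE : j.+2`! = (j.+2 * m)%N by rewrite factS.
set N := (n %/ j.+2`!)%N.
have Nn : (N * j.+2`! <= n)%N by exact: leq_divM.
(* Starting at [t = 1] keeps the terms positive when [a = 0]; stopping at [t = N - 1] gives
   [a + t * m < N * m], because [a < m]. *)
pose s := [seq (a + t * m)%N | t <- iota 1 N.-1].
have m0 : (0 < m)%N by exact: fact_gt0.
have s_uniq : uniq s.
  rewrite map_inj_uniq ?iota_uniq// => x y /addnI /eqP.
  by rewrite eqn_pmul2r// => /eqP.
have -> : (N <= (iter_rem_card j n).+1)%N = (size s <= iter_rem_card j n)%N.
  by rewrite size_map size_iota; lia.
rewrite -(undup_id s_uniq) -card_fseq.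
apply: fsubset_leq_card; apply/fsubsetP => _ /[!in_fset] /mapP[t tN ->].
move: tN; rewrite mem_iota => tN.
apply: aS; first by rewrite addn_gt0 muln_gt0 m0; lia.
  apply: leq_trans Nn; rewrite mE mulnCA mulnC ltn_pmul2l//.
  apply: (@leq_trans (t.+1 * m)); first by rewrite mulSn ltn_add2r.
  by rewrite leq_pmul2r//; lia.
by rewrite addnC modnMDl.
Qed.

Section limit_bounds.
Variable R : realType.
Implicit Types (u : nat -> \bar R) (l : \bar R).
Local Open Scope classical_set_scope.
Local Open Scope ereal_scope.

(** The limit superior is an infimum of suprema over the neighbourhoods of infinity, and the set
    where [u n <= l] is one of them. *)
Lemma limn_esup_le_near u l :
  (\forall n \near \oo, u n <= l) -> limn_esup u <= l.
Proof.
move=> ul; rewrite /limn_esup /limf_esup.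
apply: (@le_trans _ _ (ereal_sup (u @` [set n | u n <= l]))).
  by apply: ereal_inf_lbound; exists [set n | u n <= l].
by apply: ge_ereal_sup => _ [n /= un <-].
Qed.

Lemma limn_einf_ge_near u l :
  (\forall n \near \oo, l <= u n) -> l <= limn_einf u.
Proof.
move=> lu; rewrite /limn_einf leeNr; apply: limn_esup_le_near.
by apply: filterS lu => n; rewrite leeN2.
Qed.

Lemma near_infty_div_le (c e : R) :
  (0 < e)%R -> \forall n \near \oo, (0 < n)%N && (c / n%:R <= e)%R.
Proof.
move=> e0; near=> n.
have n0 : (0 < n)%N by near: n; exact: nbhs_infty_gt.
rewrite n0 ler_pdivrMr ?ltr0n// mulrC -ler_pdivrMr//.
by near: n; exact: nbhs_infty_ger.
Unshelve. all: by end_near. Qed.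

End limit_bounds.

Theorem theorem2p3 (R : realType) (j : nat) :
  let u : nat -> \bar R := fun n => ((iter_rem_card j n)%:R / n%:R)%:E in
  [/\ (((j.+2)`!%:R^-1)%:E <= limn_einf u)%E,
      (limn_einf u <= limn_esup u)%E &
      (limn_esup u <= (j.+2%:R^-1)%:E)%E].
Proof.
move=> u; split; first last.
- apply/lee_addgt0Pr => e e0; apply: limn_esup_le_near.
  (* The 1 pays for the remainder 0, counted on top of [n %/ j.+2]. *)
  apply: filterS (@near_infty_div_le R 1 e e0) => n /andP[n0 ne].
  rewrite /u -EFinD lee_fin; apply: le_trans (lerD (lexx _) ne).
  rewrite ler_pdivrMr ?ltr0n// mulrDl divfK ?pnatr_eq0 -?lt0n// mulrC.
  apply: le_trans (_ : (n %/ j.+2).+1%:R <= _).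
    by rewrite ler_nat iter_rem_card_le.
  rewrite -natr1 lerD2r ler_pdivlMr ?ltr0n// -natrM ler_nat.
  exact: leq_divM.
- exact: limn_einf_sup.
- apply/lee_subgt0Pr => e e0; apply: limn_einf_ge_near.
  apply: filterS (@near_infty_div_le R 2 e e0) => n /andP[n0 ne].
  rewrite /u -EFinB lee_fin lerBlDr; apply: le_trans (lerD (lexx _) ne).
  rewrite -mulrDl ler_pdivlMr ?ltr0n// mulrC ler_pdivrMr ?ltr0n ?fact_gt0//.
  rewrite -natrD -natrM ler_nat addn2 ltnW// -ltn_divLR ?fact_gt0// ltnS.
  exact: iter_rem_card_ge.
Qed.
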